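(* Suppose $X$ is a random variable that takes values in $[-B_2,B_1]$ almost surely, where $B_1,B_2\ge0$ and at least one of $B_1,B_2$ is positive. Let $u^+,u^-:\mathbb{R}\to[0,\infty)$ be continuous utility functions with $u^+(x)=0$ for $x\le0$ and $u^+$ increasing otherwise, and $u^-(x)=0$ for $x\ge0$ and $u^-$ decreasing otherwise; suppose $u^+$ is differentiable on $(0,\infty)$ with $k^+\le|(u^+)'|\le K^+$ and $u^-$ is differentiable on $(-\infty,0)$ with $k^-\le|(u^-)'|\le K^-$, where $K^\pm,k^\pm>0$. Let $w^+,w^-:[0,1]\to[0,1]$ be continuous, non-decreasing weight functions with $w^\pm(0)=0$, $w^\pm(1)=1$, that are Hölder continuous with exponent $\alpha\in(0,1]$ and constant $L>0$, i.e. $|w^\pm(p)-w^\pm(q)|\le L|p-q|^\alpha$ for all $p,q\in[0,1]$. Let $\tau=\max\left\{B_1\frac{K^+}{k^+},B_2\frac{K^-}{k^-}\right\}$. Then, for every $\epsilon>0$ and $n\ge1$, $$\mathbb{P}\left(|C_n-C(X)|>\epsilon\right)\le c_1\exp\left(-c_2n\left[\frac{\epsilon}{L\tau^{1-\alpha}}\right]^{2/\alpha}\right),$$ where $c_1$ and $c_2$ are constants that depend on $B_1,B_2$.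
   Context: For a random variable $X$ with CDF $F$, the cumulative prospect theory (CPT) value is $$C(F)=C(X)=\int_0^\infty w^+\left(\mathbb{P}(u^+(X)>z)\right)dz-\int_0^\infty w^-\left(\mathbb{P}(u^-(X)>z)\right)dz.$$ Given i.i.d. samples $X_1,\dots,X_n$ from $F$ with empirical distribution function $F_n(x)=\frac1n\sum_{i=1}^n\mathbf 1\{X_i\le x\}$, the estimate is $C_n=C(F_n)$. (For samples in $[-B_2,B_1]$ this equals the CPT-value of the truncated CDF $F_n|_\tau(x)=F_n(x)\mathbf 1\{-\tau\le x<\tau\}+\mathbf 1\{x\ge\tau\}$.)
   Formalization: The constants c_1, c_2 may depend on K^+, K^- and α as well as on B_1, B_2: with dependence on B_1, B_2 alone the bound fails (u^+(x)=K max(x,0), w the identity, X Bernoulli(1/2), n=1, K large). *)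

(* Defs.v *)
From HB Require Import structures.
From mathcomp Require Import all_boot all_order all_algebra.
From mathcomp Require Import all_classical all_reals all_analysis.

Set Implicit Arguments.
Unset Strict Implicit.
Unset Printing Implicit Defensive.

Import Order.TTheory GRing.Theory Num.Theory.
Import numFieldNormedType.Exports.

Local Open Scope classical_set_scope.
Local Open Scope ring_scope.

Definition gain_utility (R : realType) (k K : R) (u : R -> R) : Prop :=
  [/\ (forall x, 0 <= u x) /\ continuous u,
      forall x, x <= 0 -> u x = 0,
      forall x y, 0 < x -> x < y -> u x < u y &
      forall x, 0 < x -> derivable u x 1 /\ k <= `|derive1 u x| <= K].

Definition loss_utility (R : realType) (k K : R) (u : R -> R) : Prop :=
  [/\ (forall x, 0 <= u x) /\ continuous u,
      forall x, 0 <= x -> u x = 0,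
      forall x y, x < y -> y < 0 -> u y < u x &
      forall x, x < 0 -> derivable u x 1 /\ k <= `|derive1 u x| <= K].

(* A weight function [0,1] -> [0,1] is represented by a function on R of which
   only the values on [0,1] matter. *)
Definition weight_function (R : realType) (w : R -> R) : Prop :=
  [/\ forall p, 0 <= p <= 1 -> 0 <= w p <= 1,
      {within `[0, 1], continuous w},
      forall p q, 0 <= p -> p <= q -> q <= 1 -> w p <= w q,
      w 0 = 0 & w 1 = 1].

Definition holder01 (R : realType) (alpha L : R) (w : R -> R) : Prop :=
  forall p q, 0 <= p <= 1 -> 0 <= q <= 1 ->
    `|w p - w q| <= L * `|p - q| `^ alpha.

Section CPT.
Context {R : realType}.
Variables up um wp wm : R -> R.

Definition cpt_law (mu : set R -> \bar R) : R :=
  \int[lebesgue_measure]_(z in `[0, +oo[) wp (fine (mu [set x | z < up x]))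
  - \int[lebesgue_measure]_(z in `[0, +oo[) wm (fine (mu [set x | z < um x])).

(* C(F): the probabilities are taken under the Borel measure on R whose
   distribution function is F. *)
Definition cpt_cdf (F : cumulative R R) : R :=
  cpt_law (lebesgue_stieltjes_measure F).

(* C(X): here distribution P X [set x | z < u x] is P(u(X) > z). *)
Definition cpt d (T : measurableType d) (P : probability T R)
  (X : {RV P >-> R}) : R := cpt_law (distribution P X).

End CPT.

Section ECDF.
Context {R : realType} (n : nat).
Variable s : 'I_n -> R.

Definition ecdf (x : R) : R := n%:R^-1 * \sum_(i < n) (s i <= x)%R%:R.

Let ecdf_nd : nondecreasing ecdf.
Proof.
move=> x y xy; rewrite /ecdf ler_wpM2l ?invr_ge0//.
apply: ler_sum => i _; rewrite ler_nat.
by case: leP => // six; rewrite (le_trans six xy).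
Qed.

Let ecdf_rc : right_continuous ecdf.
Proof.
move=> x; apply: cvg_near_cst.
have /filter_forall H i : \forall y \near x^'+, (s i <= y) = (s i <= x).
  have [six|xsi] := leP (s i) x; near=> y; first by rewrite (le_trans six).
  by rewrite leNgt (_ : y < s i)//; near: y; exact: nbhs_right_lt.
near=> y; congr (_ * _); apply: eq_bigr => i _; congr (_%:R).
by congr nat_of_bool; move: i; near: y; exact: H.
Unshelve. all: by end_near. Qed.

HB.instance Definition _ := isCumulative.Build R _ R ecdf ecdf_nd ecdf_rc.

End ECDF.

(* C_n = C(F_n) as a function of the outcome. *)
Definition cpt_est (R : realType) (up um wp wm : R -> R)
    d (T : measurableType d) (P : probability T R)
    (n : nat) (Xs : 'I_n -> {RV P >-> R}) (t : T) : R :=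
  cpt_cdf up um wp wm (ecdf (fun i => Xs i t)).

Definition mutually_independent (R : realType) d (T : measurableType d)
    (P : probability T R) (n : nat) (Xs : 'I_n -> {RV P >-> R}) : Prop :=
  forall (J : {set 'I_n}) (A : 'I_n -> set R),
    (forall i, measurable (A i)) ->
    (P (\bigcap_(i in [set` J]) (Xs i @^-1` A i)) =
     \prod_(i in J) P (Xs i @^-1` A i))%E.

Definition iid_sample (R : realType) d (T : measurableType d)
    (P : probability T R) (X : {RV P >-> R})
    (n : nat) (Xs : 'I_n -> {RV P >-> R}) : Prop :=
  mutually_independent Xs /\
  forall i (A : set R), measurable A ->
    distribution P (Xs i) A = distribution P X A.

(* Main.v *)
Require Import Defs.
From HB Require Import structures.
From mathcomp Require Import all_boot all_order all_algebra.
From mathcomp Require Import all_classical all_reals all_analysis.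
From mathcomp Require Import measurable_realfun.
From mathcomp Require Import ring lra.

Set Implicit Arguments.
Unset Strict Implicit.
Unset Printing Implicit Defensive.

Import Order.TTheory GRing.Theory Num.Theory.
Import numFieldNormedType.Exports.

Local Open Scope classical_set_scope.
Local Open Scope ring_scope.

(* Let D_t(z) be the difference at z between the empirical and the true tails of
   u(X), for the outcome t. On [0, U], where U bounds u(X), comparing the concave
   power with the convex exponential at a free point x gives
     |D|^alpha <= x^alpha (1 + kappa (exp(lambda (|D| - x)) - 1)),
   so that an error of the CPT integral above L U x^alpha forces the integral of
   exp(lambda |D_t(z)|) over z in [0, U] above U exp(lambda x). By Markov and
   Tonelli this is controlled by the moment generating function of D_t(z) at a
   single z, a centred average of independent Bernoulli variables. No uniform
   (Dvoretzky-Kiefer-Wolfowitz) inequality is needed, and the constant in front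
   of the exponential does not depend on n; lambda = n x / 4 optimises the
   bound. *)

(** * The measure attached to an empirical distribution function *)

(** The average of the Dirac masses at the samples is a measure that agrees with the Stieltjes
    measure on the intervals []a, b]], and these determine the latter. *)
Lemma lebesgue_stieltjes_ecdf (R : realType) n (s : 'I_n -> R) (A : set R) :
  measurable A ->
  lebesgue_stieltjes_measure (ecdf s) A
  = (n%:R^-1 * \sum_(i < n) \1_A (s i))%:E.
Proof.
move=> mA.
(* [msum] sums a sequence indexed by natural numbers, so the samples are extended by 0; only the
   first [n] terms enter the sum. *)
pose x k : measurableTypeR R := if insub k is Some i then s i else 0.
have xE (i : 'I_n) : x i = s i by rewrite /x valK.
have n0 : 0 <= n%:R^-1 :> R by rewrite invr_ge0.
pose mu : {measure set (measurableTypeR R) -> \bar R} :=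
  mscale (NngNum n0) (msum (fun k => dirac (x k : measurableTypeR R)) n).
have muE B : mu B = (n%:R^-1 * \sum_(i < n) \1_B (s i))%:E.
  rewrite /mu /mscale/= /msum EFinM -sumEFin; congr (_ * _)%E.
  by apply: eq_bigr => i _; rewrite xE.
rewrite -muE; apply: lebesgue_stieltjes_measure_unique => [I [[a b]]/= _ <- | //].
rewrite /lebesgue_stieltjes_measure /measure_extension/=.
rewrite measurable_mu_extE/=; last exact: is_ocitv.
rewrite [RHS]muE.
have [ab | ba] := leP a b; last first.
  rewrite set_itv_ge ?wlength0 ?bnd_simp -?leNgt ?ltW//.
  by rewrite big1 ?mulr0// => i _; rewrite indic0.
rewrite wlength_itv_bnd// /ecdf -mulrBr -sumrB; congr (_ * _)%:E.
apply: eq_bigr => i _; rewrite indicE mem_setE in_itv/=.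
rewrite [a < _]ltNge.
case: (leP (s i) a) => [sa|]/=; last by rewrite subr0.
by rewrite (le_trans sa ab) subrr.
Qed.

(** * Scalar inequalities and the moment generating function of an empirical frequency *)

(** Isolates a linear term, which averages out for a centred variable. Above 1/2 the square term
    alone suffices, as [x <= 2 * x ^+ 2]. Otherwise exp(x) <= 1/(1 - x), and (1 + x + 2x^2)(1 - x) =
    1 + x^2 (1 - 2x) >= 1. *)
Lemma expR_le_id_expR_sqr (R : realType) (x : R) : expR x <= x + expR (2 * x ^+ 2).
Proof.
have [x_le|x_gt] := leP x (2^-1); last first.
  rewrite (@le_trans _ _ (expR (2 * x ^+ 2)))//; first by rewrite ler_expR; nra.
  by rewrite lerDr; lra.
have e1 := expR_ge1Dx (2 * x ^+ 2).
suff : expR x <= 1 + x + 2 * x ^+ 2 by lra.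
have e2 : expR x * (1 - x) <= 1.
  by rewrite -[leRHS](expRxMexpNx_1 x) ler_wpM2l ?expR_ge0// expR_ge1Dx.
have x1 : 0 < 1 - x by lra.
rewrite -(ler_pM2r x1) (le_trans e2)//.
have : 0 <= x ^+ 2 * (1 - 2 * x) by rewrite mulr_ge0 ?sqr_ge0//; lra.
nra.
Qed.

(** A weak form of Hoeffding's lemma: the previous bound is applied at the two values s(1 - p) and
    -sp of the centred variable, whose linear terms cancel under the weights p and 1 - p. *)
Lemma centered_bernoulli_mgf (R : realType) (p s : R) : 0 <= p <= 1 ->
  expR (- (s * p)) * (p * expR s + (1 - p)) <= expR (2 * s ^+ 2).
Proof.
move=> /andP[p0 p1].
have -> : expR (- (s * p)) * (p * expR s + (1 - p))
    = p * expR (s * (1 - p)) + (1 - p) * expR (- (s * p)).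
  by rewrite mulrDr mulrCA -expRD; congr (_ * expR _ + _); [ring|rewrite mulrC].
have e1 := expR_le_id_expR_sqr (s * (1 - p)).
have e2 := expR_le_id_expR_sqr (- (s * p)).
have s2 : 0 <= s ^+ 2 by rewrite sqr_ge0.
have e3 : expR (2 * (s * (1 - p)) ^+ 2) <= expR (2 * s ^+ 2).
  by rewrite ler_expR exprMn ler_pM2l// ler_piMr// expr_le1//; lra.
have e4 : expR (2 * (- (s * p)) ^+ 2) <= expR (2 * s ^+ 2).
  by rewrite ler_expR sqrrN exprMn ler_pM2l// ler_piMr// expr_le1//; lra.
have q0 : 0 <= 1 - p by lra.
have := ler_wpM2l p0 (le_trans e1 (lerD (lexx _) e3)).
have := ler_wpM2l q0 (le_trans e2 (lerD (lexx _) e4)).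
set E := expR (2 * s ^+ 2).
lra.
Qed.

(** For y > 0 this is convexity of exp between ln y and 0 with weights a and 1 - a; y = 0 has no
    logarithm and is treated apart. *)
Lemma powR_le_tangent (R : realType) (a y : R) : 0 < a -> a <= 1 -> 0 <= y ->
  y `^ a <= 1 + a * (y - 1).
Proof.
move=> a0 a1; rewrite le_eqVlt => /predU1P[<-|y0].
  by rewrite powR0 ?gt_eqF//; lra.
have a01 : 0 <= a <= 1 by rewrite ltW.
have := @convex_expR R (Itv01 (ltW a0) a1) (ln y) 0.
rewrite !convRE/= expR0 lnK ?posrE// /powR gt_eqF//.
rewrite mulr0 addr0 mulr1 => /le_trans; apply.
by rewrite le_eqVlt; apply/orP; left; apply/eqP; rewrite mulrBr mulr1 addrCA.
Qed.

(* The concave power and the convex exponential are compared through their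
   tangents at the same point [x]. *)
Lemma powR_le_expR (R : realType) (alpha lambda x a : R) :
  0 < alpha -> alpha <= 1 -> 0 < lambda -> 0 < x -> 0 <= a ->
  a `^ alpha <=
  x `^ alpha * (1 + alpha / (lambda * x) * (expR (lambda * (a - x)) - 1)).
Proof.
move=> al0 al1 l0 x0 a0.
rewrite -{1}(divfK (lt0r_neq0 x0) a) powRM ?divr_ge0 ?(ltW x0)// mulrC.
rewrite ler_wpM2l ?powR_ge0//.
rewrite (le_trans (powR_le_tangent al0 al1 _)) ?divr_ge0 ?(ltW x0)//.
rewrite lerD2l// -mulrA ler_pM2l//.
have -> : a / x - 1 = (lambda * x)^-1 * (lambda * (a - x)).
  by field; rewrite !gt_eqF.
rewrite ler_pM2l ?invr_gt0 ?mulr_gt0//.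
have := expR_ge1Dx (lambda * (a - x)); lra.
Qed.

(* Only the product rule for events is available: [h] of an indicator is split
   over the two values of the indicator and the product is expanded. *)
Lemma expectation_prod_independent (R : realType) d (T : measurableType d)
    (P : probability T R) n (Xs : 'I_n -> {RV P >-> R}) (A : set R)
    (h : bool -> R) :
  mutually_independent Xs -> measurable A -> (forall b, 0 <= h b) ->
  (\int[P]_t (\prod_(i < n) h (Xs i t \in A))%:E)%E =
  (\prod_(i < n) (h true * fine (P (Xs i @^-1` A))
                  + h false * (1 - fine (P (Xs i @^-1` A)))))%:E.
Proof.
move=> indep mA h0.
pose S b := if b then A else ~` A.
have mS b : measurable (S b) by case: b => //; exact: measurableC.
have mXS i b : measurable (Xs i @^-1` S b).
  by rewrite -[X in measurable X]setTI; exact: measurable_funPT.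
have mcap (f : {ffun 'I_n -> bool}) :
    measurable (\bigcap_(i in [set` [set: 'I_n]%SET]) (Xs i @^-1` S (f i))).
  by apply: fin_bigcap_measurable => //; exact: finite_finset.
have expand t : \prod_(i < n) h (Xs i t \in A) =
    \sum_(f : {ffun 'I_n -> bool}) (\prod_(i < n) h (f i)) *
      \1_(\bigcap_(i in [set` [set: 'I_n]%SET]) (Xs i @^-1` S (f i))) t.
  transitivity (\prod_(i < n) \sum_(b : bool) h b * \1_(Xs i @^-1` S b) t : R).
    apply: eq_bigr => i _; rewrite big_bool !indicE.
    have memE b : (t \in Xs i @^-1` S b) = (Xs i t \in S b).
      by apply/idP/idP => /set_mem ?; exact/mem_set.
    rewrite (memE true) (memE false) in_setC.
    by case: (Xs i t \in A) => /=; rewrite !(mulr1, mulr0, addr0, add0r).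
  rewrite bigA_distr_bigA/=; apply: eq_bigr => f _; rewrite big_split/=.
  congr (_ * _); rewrite indicE.
  have [tin|tnin] := boolP (t \in _).
    rewrite big1// => i _; rewrite indicE mem_set//.
    by move: tin => /set_mem/(_ i); apply; rewrite /= inE.
  have [i ti] : exists i, ~ (Xs i @^-1` S (f i)) t.
    apply/existsNP => H; move/negP: tnin; apply; apply/mem_set => i _; exact: H.
  by rewrite (bigD1 i)//= indicE memNset// mul0r.
under eq_integral do rewrite expand -sumEFin.
rewrite ge0_integral_sum//; last 2 first.
- by move=> f; apply/measurable_EFinP; exact: measurable_funM.
- by move=> f t _; rewrite lee_fin mulr_ge0// prodr_ge0.
transitivity (\sum_(f : {ffun 'I_n -> bool})
    (\prod_(i < n) (h (f i) * fine (P (Xs i @^-1` S (f i)))))%:E)%E.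
  apply: eq_bigr => f _.
  under eq_integral do rewrite EFinM.
  rewrite ge0_integralZl//; last 2 first.
  - by apply/measurable_EFinP.
  - by rewrite lee_fin prodr_ge0.
  rewrite integral_indic// setIT big_split/= EFinM; congr (_ * _)%E.
  apply: (etrans (indep _ (fun i => S (f i)) _)) => //.
  rewrite -prodEFin; apply: eq_big => [i|i _]; first by rewrite inE.
  by rewrite fineK// fin_num_measure.
(* Distributivity read backwards: the sum over all patterns of indicator values folds into a product
   of two-term sums. *)
rewrite sumEFin -(bigA_distr_bigA (fun i b => h b * fine (P (Xs i @^-1` S b)))).
congr (_%:E); apply: eq_bigr => i _; rewrite big_bool/=.
rewrite preimage_setC probability_setC; last exact: (mXS i true).
congr (_ + _ * _); transitivity (fine (1 - (fine (P (Xs i @^-1` A)))%:E)%E) => //.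
by congr (fine (1 - _)%E); apply/esym; exact: (fineK (fin_num_measure P _ (mXS i true))).
Qed.

(** With s = lambda/n the exponential is a product of one factor per sample. Independence factors
    the expectation, and n factors bounded by exp(2 s^2) give exp(2 lambda^2 / n). The sign of
    [lambda] is free, so both one-sided deviations are covered. *)
Lemma empirical_mgf (R : realType) d (T : measurableType d)
    (P : probability T R) (X : {RV P >-> R}) n (Xs : 'I_n -> {RV P >-> R})
    (A : set R) (lambda : R) :
  iid_sample X Xs -> measurable A -> (0 < n)%N ->
  (\int[P]_t (expR (lambda * (n%:R^-1 * \sum_(i < n) (Xs i t \in A)%:R
                             - fine (distribution P X A))))%:E
   <= (expR (2 * lambda ^+ 2 / n%:R))%:E)%E.
Proof.
move=> [indep same] mA n0.
have nR0 : n%:R != 0 :> R by rewrite pnatr_eq0 -lt0n.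
set p := fine (distribution P X A).
have p01 : 0 <= p <= 1.
  rewrite fine_ge0//= -lee_fin fineK ?fin_num_measure//.
  exact: probability_le1.
pose s := lambda / n%:R.
pose h (b : bool) := expR (s * (b%:R - p)).
have prodE t : expR (lambda * (n%:R^-1 * \sum_(i < n) (Xs i t \in A)%:R - p)) =
    \prod_(i < n) h (Xs i t \in A).
  rewrite -expR_sum; congr expR.
  rewrite -mulr_sumr sumrB sumr_const card_ord mulrBr mulrBr mulrA; congr (_ - _).
  by rewrite mulrnAr -mulrnAl -mulr_natr divfK.
under eq_integral do rewrite prodE.
rewrite expectation_prod_independent//; last by move=> b; exact: expR_ge0.
rewrite lee_fin.
under eq_bigr => i _ do rewrite [P _](same i A mA).
rewrite prodr_const card_ord -/p.
have -> : h true * p + h false * (1 - p)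
    = expR (- (s * p)) * (p * expR s + (1 - p)).
  rewrite [RHS]mulrDr [X in _ = X + _]mulrCA -expRD [X in _ = X + _]mulrC.
  by rewrite /h /= mulr1n mulr0n; congr (expR _ * _ + expR _ * _); ring.
rewrite (@le_trans _ _ (expR (2 * s ^+ 2) ^+ n))//.
  rewrite lerXn2r ?nnegrE ?expR_ge0 ?centered_bernoulli_mgf//.
  rewrite mulr_ge0 ?expR_ge0// addr_ge0 ?mulr_ge0 ?expR_ge0//.
    by case/andP: p01.
  by rewrite subr_ge0; case/andP: p01.
rewrite -expRM_natl ler_expR le_eqVlt; apply/orP; left; apply/eqP.
by rewrite /s; field.
Qed.

(** * Tails, their measurability, and exchange of integrals *)

Definition tail_prob (R : realType) (u : R -> R) d (T : measurableType d)
    (P : probability T R) (X : {RV P >-> R}) (z : R) : R :=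
  fine (distribution P X [set x | z < u x]).

(** The explicit form of the tail under [ecdf s], identified with it in [cpt_estE]; as a finite sum
    it is easily seen to be measurable jointly in outcome and level. *)
Definition empirical_tail (R : realType) (u : R -> R) n (s : 'I_n -> R) (z : R)
    : R :=
  n%:R^-1 * \sum_(i < n) (z < u (s i))%R%:R.

Lemma measurable_superlevel (R : realType) d (S : measurableType d)
    (f : S -> R) (z : R) :
  measurable_fun setT f -> measurable [set x | z < f x].
Proof.
move=> mf; have := mf measurableT _ (measurable_itv `]z, +oo[).
rewrite setTI; congr measurable; apply/seteqP.
by split => x /=; rewrite in_itv/= andbT.
Qed.

Lemma measurable_deviation (R : realType) d (S : measurableType d) (f : S -> R)
    (b c : R) :
  measurable_fun setT f -> measurable [set x | c < `|f x - b|].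
Proof.
move=> mf; apply: measurable_superlevel.
by apply: measurableT_comp => //; exact: measurable_funB.
Qed.

Lemma tail_prob_01 (R : realType) (u : R -> R) d (T : measurableType d)
    (P : probability T R) (X : {RV P >-> R}) (z : R) :
  measurable_fun setT u -> 0 <= tail_prob u X z <= 1.
Proof.
move=> mu; have mA := measurable_superlevel z mu.
rewrite fine_ge0//= -lee_fin fineK ?fin_num_measure//; exact: probability_le1.
Qed.

Lemma empirical_tail_01 (R : realType) (u : R -> R) n (s : 'I_n -> R) (z : R) :
  0 <= empirical_tail u s z <= 1.
Proof.
rewrite /empirical_tail; have [->|n0] := eqVneq (n%:R : R) 0.
  by rewrite invr0 mul0r lexx ler01.
rewrite mulr_ge0 ?invr_ge0 ?sumr_ge0//=.
rewrite mulrC ler_pdivrMr ?lt0r ?n0//= mul1r.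
rewrite (@le_trans _ _ (\sum_(i < n) 1))//; last by rewrite sumr_const card_ord.
by apply: ler_sum => i _; case: (_ < _).
Qed.

Lemma measurable_tail_prob (R : realType) (u : R -> R) d (T : measurableType d)
    (P : probability T R) (X : {RV P >-> R}) :
  measurable_fun setT u -> measurable_fun setT (tail_prob u X).
Proof.
move=> mu; apply: nonincreasing_measurable => // y z yz.
have mA r := measurable_superlevel r mu.
rewrite fine_le ?fin_num_measure// le_measure ?inE// => x /=.
exact: le_lt_trans.
Qed.

(** Joint measurability is what Tonelli's theorem asks for. Each summand is the indicator of a set
    cut out by comparing two measurable functions on the product space. *)
Lemma measurable_empirical_tail (R : realType) (u : R -> R) d
    (T : measurableType d) (P : probability T R) n (Xs : 'I_n -> {RV P >-> R}) :
  measurable_fun setT u ->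
  measurable_fun setT
    (fun tz : T * R => empirical_tail u (Xs ^~ tz.1) tz.2).
Proof.
move=> mu; apply: measurable_funM => //; apply: measurable_sum => i.
pose A := [set tz : T * R | tz.2 < u (Xs i tz.1)].
have mA : measurable A.
  have /(_ measurableT [set true]) : measurable_fun setT
      (fun tz : T * R => tz.2 < u (Xs i tz.1)).
    apply: measurable_fun_ltr; first exact: measurable_snd.
    apply: measurableT_comp => //; apply: measurableT_comp => //.
  by rewrite setTI; apply.
rewrite (_ : (fun _ => _) = \1_A); first exact: measurable_indic.
apply/funext => tz; rewrite indicE; congr (_%:R); congr nat_of_bool.
by apply/idP/idP => [|/set_mem//]; exact/mem_set.
Qed.

(* [w] is monotone on [0,1] only, hence the clamping to [0,1] in the proof. *)
Lemma measurable_weight (R : realType) (w : R -> R) d (S : measurableType d)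
    (f : S -> R) :
  weight_function w -> (forall x, 0 <= f x <= 1) -> measurable_fun setT f ->
  measurable_fun setT (w \o f).
Proof.
move=> [_ _ w_nd _ _] f01 mf.
pose c (p : R) : R := Num.max 0 (Num.min 1 p).
rewrite (_ : w \o f = (w \o c) \o f).
  apply: measurableT_comp => //; apply: nondecreasing_measurable => // p q pq.
  rewrite /= /c w_nd//.
  - by rewrite le_max lexx.
  - by rewrite ge_max !le_max lexx/= le_min !ge_min lexx pq !orbT.
  - by rewrite ge_max ler01/= ge_min lexx.
apply/funext => x /=; congr w; rewrite /c; have /andP[f0 f1] := f01 x.
by rewrite min_r// max_r.
Qed.

Lemma tonelli_section (R : realType) d (T : measurableType d)
    (P : probability T R) (D : set R) (f : T * R -> R) :
  measurable D -> measurable_fun setT f -> (forall x, 0 <= f x) ->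
  measurable_fun setT
    (fun t => \int[lebesgue_measure]_(z in D) (f (t, z))%:E)%E /\
  (\int[P]_t \int[lebesgue_measure]_(z in D) (f (t, z))%:E =
   \int[lebesgue_measure]_(z in D) \int[P]_t (f (t, z))%:E)%E.
Proof.
move=> mD mf f0.
(* Multiplying by the indicator of [D] reduces the claim to Tonelli's theorem on the whole product
   space. *)
pose g (x : T * R) := (f x * \1_D x.2)%:E.
have mg : measurable_fun setT g.
  apply/measurable_EFinP; apply: measurable_funM => //.
  by apply: measurableT_comp => //; exact: measurable_snd.
have g0 x : (0 <= g x)%E by rewrite lee_fin mulr_ge0.
have gE t : (\int[lebesgue_measure]_(z in D) (f (t, z))%:E =
    \int[lebesgue_measure]_z g (t, z))%E.
  rewrite integral_mkcond; apply: eq_integral => z _.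
  by rewrite patchE /g/= indicE; case: ifPn => zD; rewrite ?mulr1 ?mulr0.
split.
  under eq_fun do rewrite gE.
  exact: (measurable_fun_fubini_tonelli_F (m2 := lebesgue_measure) g).
under eq_integral do rewrite gE.
apply: (etrans (fubini_tonelli (m1 := P) (m2 := lebesgue_measure) g _ _)) => //.
rewrite [RHS]integral_mkcond.
apply: eq_integral => z _; rewrite patchE.
case: ifPn => zD; rewrite /g/= indicE.
  by rewrite zD; under eq_integral do rewrite mulr1.
by rewrite (negbTE zD); under eq_integral do rewrite mulr0; rewrite integral0.
Qed.

(** Makes the deviation events measurable. The real-valued integral is [fine] of an extended one,
    hence the final composition. *)
Lemma measurable_cpt_part (R : realType) (u w : R -> R) d
    (T : measurableType d) (P : probability T R) n (Xs : 'I_n -> {RV P >-> R}) :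
  measurable_fun setT u -> weight_function w ->
  measurable_fun setT (fun t : T =>
    \int[lebesgue_measure]_(z in `[0, +oo[) w (empirical_tail u (Xs ^~ t) z)).
Proof.
move=> mu ww; have [w01 _ _ _ _] := ww.
pose f (x : T * R) := w (empirical_tail u (Xs ^~ x.1) x.2).
have mf : measurable_fun setT f.
  apply: (measurable_weight (f := fun x => empirical_tail u (Xs ^~ x.1) x.2)) => //.
    by move=> x; exact: empirical_tail_01.
  exact: measurable_empirical_tail.
have f0 x : 0 <= f x.
  by have /w01/andP[] := empirical_tail_01 u (Xs ^~ x.1) x.2.
have [mF _] := tonelli_section P (measurable_itv `[0, +oo[) mf f0.
exact: measurableT_comp (fine_measurable _) mF.
Qed.

(** * Exponential moments of the tail deviation, integrated over levels *)

(** This is 2 cosh(lambda D), with D the deviation of the tails. It dominates exp(lambda |D|), and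
    each summand has an expectation controlled by [empirical_mgf]. *)
Definition exp_deviation (R : realType) (u : R -> R) d (T : measurableType d)
    (P : probability T R) (X : {RV P >-> R}) n (Xs : 'I_n -> {RV P >-> R})
    (lambda : R) (x : T * R) : R :=
  expR (lambda * (empirical_tail u (Xs ^~ x.1) x.2 - tail_prob u X x.2)) +
  expR (- lambda * (empirical_tail u (Xs ^~ x.1) x.2 - tail_prob u X x.2)).

Lemma measurable_exp_deviation (R : realType) (u : R -> R) d
    (T : measurableType d) (P : probability T R) (X : {RV P >-> R})
    n (Xs : 'I_n -> {RV P >-> R}) (lambda : R) :
  measurable_fun setT u -> measurable_fun setT (exp_deviation u X Xs lambda).
Proof.
move=> mu; have mdev : measurable_fun setT (fun x : T * R =>
    empirical_tail u (Xs ^~ x.1) x.2 - tail_prob u X x.2).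
  apply: measurable_funB; first exact: measurable_empirical_tail.
  apply: measurableT_comp; first exact: measurable_tail_prob.
  exact: measurable_snd.
by apply: measurable_funD; apply: measurableT_comp => //; apply: measurable_funM.
Qed.

(** Tonelli brings the expectation inside; at every level it is at most twice the bound of
    [empirical_mgf], and the levels fill an interval of length U. *)
Lemma expectation_integral_exp_deviation (R : realType) (u : R -> R) d
    (T : measurableType d) (P : probability T R) (X : {RV P >-> R})
    n (Xs : 'I_n -> {RV P >-> R}) (lambda U : R) :
  measurable_fun setT u -> iid_sample X Xs -> (0 < n)%N -> 0 < U ->
  (\int[P]_t \int[lebesgue_measure]_(z in `[0%R, U[)
      (exp_deviation u X Xs lambda (t, z))%:E
   <= (U * (2 * expR (2 * lambda ^+ 2 / n%:R)))%:E)%E.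
Proof.
move=> mu iid n0 U0.
have mM := measurable_exp_deviation X Xs lambda mu.
have M0 x : 0 <= exp_deviation u X Xs lambda x by rewrite addr_ge0 ?expR_ge0.
have [_ ->] := tonelli_section P (measurable_itv `[0, U[) mM M0.
have mgf l z : (\int[P]_t (expR (l * (empirical_tail u (Xs ^~ t) z
    - tail_prob u X z)))%:E <= (expR (2 * l ^+ 2 / n%:R))%:E)%E.
  have tailE t : n%:R^-1 * \sum_(i < n) (Xs i t \in [set x | z < u x])%:R =
      empirical_tail u (Xs ^~ t) z.
    congr (_ * _); apply: eq_bigr => i _; congr (_%:R); congr nat_of_bool.
    by apply/idP/idP => [/set_mem//|?]; exact/mem_set.
  have := empirical_mgf l iid (measurable_superlevel z mu) n0.
  by under eq_integral do rewrite tailE.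
have mexp l z : measurable_fun setT (fun t => (expR (l *
    (empirical_tail u (Xs ^~ t) z - tail_prob u X z)))%:E).
  apply/measurable_EFinP; apply: measurableT_comp => //.
  apply: measurable_funM => //; apply: measurable_funB => //.
  exact: measurableT_comp (measurable_empirical_tail Xs mu) (pair2_measurable z).
apply: (@le_trans _ _ (\int[lebesgue_measure]_(z in `[0%R, U[)
    (2 * expR (2 * lambda ^+ 2 / n%:R))%:E)%E).
  apply: ge0_le_integral => //.
  - by move=> z _; apply: integral_ge0 => t _; rewrite lee_fin.
  - have := measurable_fun_fubini_tonelli_G (m1 := P)
      (EFin \o exp_deviation u X Xs lambda).
    move=> h; apply: measurable_funS (h _ _) => //.
    exact/measurable_EFinP.
  - move=> z _.
    pose e l t := (expR (l *
      (empirical_tail u (Xs ^~ t) z - tail_prob u X z)))%:E.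
    have e0 l t : (0 <= e l t)%E by rewrite lee_fin expR_ge0.
    have -> : (\int[P]_t (exp_deviation u X Xs lambda (t, z))%:E =
        \int[P]_t (e lambda t + e (- lambda)%R t))%E by [].
    rewrite ge0_integralD//; last 2 first.
    + exact: mexp.
    + exact: mexp.
    rewrite mulr_natl mulr2n EFinD leeD ?mgf//.
    by have := mgf (- lambda) z; rewrite sqrrN.
rewrite integral_cst//= lebesgue_measure_itv/= lte_fin U0 oppr0 adde0.
by rewrite -EFinM mulrC.
Qed.

(** * Comparison of integrals, almost sure bounds and Markov's inequality *)

Lemma integrable_bounded_itv (R : realType) (U C : R) (f : R -> R) :
  measurable_fun setT f -> (forall z, `|f z| <= C) ->
  lebesgue_measure.-integrable `[0, U[ (EFin \o f).
Proof.
move=> mf fC; apply: measurable_bounded_integrable => //.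
- by rewrite /= lebesgue_measure_itv/=; case: ifPn => // _; rewrite -EFinB ltry.
- exact: measurable_funS mf.
- by exists C; split; rewrite ?num_real// => x Cx y _ /=; exact: le_trans (ltW Cx).
Qed.

(** The signs of [a] and [b] are left free: in the application [a] is negative when alpha/(lambda x)
    > 1. *)
Lemma le_dist_Rintegral (R : realType) d (S : measurableType d)
    (mu : {measure set S -> \bar R}) (D : set S) (a b : R) (f g m : S -> R) :
  measurable D -> (mu D < +oo)%E ->
  mu.-integrable D (EFin \o f) -> mu.-integrable D (EFin \o g) ->
  mu.-integrable D (EFin \o m) ->
  (forall z, D z -> `|f z - g z| <= a + b * m z) ->
  `|\int[mu]_(z in D) f z - \int[mu]_(z in D) g z|
  <= a * fine (mu D) + b * \int[mu]_(z in D) m z.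
Proof.
move=> mD Dfin fi gi mi fgm.
have fgi : mu.-integrable D (EFin \o (fun z => f z - g z)).
  by have := integrableB mD fi gi; apply: eq_integrable.
have bmi : mu.-integrable D (EFin \o (fun z => b * m z)).
  by have := integrableZl mD b mi; apply: eq_integrable.
have ai : mu.-integrable D (EFin \o (fun=> a : R)).
  by apply: measurable_bounded_integrable => //; exact: bounded_cst.
rewrite -RintegralB// (le_trans (le_normr_Rintegral mD fgi))//.
rewrite -Rintegral_cst// -RintegralZl// -RintegralD//.
apply: le_Rintegral => //.
  by have := integrable_norm fgi; apply: eq_integrable.
by have := integrableD mD ai bmi; apply: eq_integrable.
Qed.

Lemma Rintegral_weight_trunc (R : realType) (U : R) (w f : R -> R) :
  w 0 = 0 -> (forall z, U <= z -> f z = 0) ->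
  \int[lebesgue_measure]_(z in `[0, +oo[) w (f z) =
  \int[lebesgue_measure]_(z in `[0, U[) w (f z).
Proof.
move=> w0 fU; rewrite Rintegral_mkcond [RHS]Rintegral_mkcond.
apply: eq_Rintegral => z _; rewrite !patchE !mem_setE !in_itv/= andbT.
case: (0 <= z) => //=; case: ltP => // Uz; by rewrite fU// w0.
Qed.

(** The bound on u(X) says that a superlevel set is null for the law of X. Every sample has that
    law, and finitely many null events have a null union. *)
Lemma sample_le_ae (R : realType) (u : R -> R) d (T : measurableType d)
    (P : probability T R) (X : {RV P >-> R}) n (Xs : 'I_n -> {RV P >-> R})
    (U : R) :
  measurable_fun setT u -> iid_sample X Xs -> {ae P, forall t, u (X t) <= U} ->
  distribution P X [set x | U < u x] = 0%E /\
  {ae P, forall t, forall i, u (Xs i t) <= U}.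
Proof.
move=> mu [_ same] XU; have mA := measurable_superlevel U mu.
have mXA (Y : {RV P >-> R}) : measurable (Y @^-1` [set x | U < u x]).
  by rewrite -[X in measurable X]setTI; exact: measurable_funPT.
have PX0 : P (X @^-1` [set x | U < u x]) = 0%E.
  apply/negligibleP; first exact: mXA.
  apply: negligibleS XU => t /=.
  by move=> Ut; apply/negP; rewrite -ltNge.
split=> //; apply: filter_forall => i.
exists (Xs i @^-1` [set x | U < u x]); split => //.
  by rewrite -PX0; exact: (same i _ mA).
by move=> t /= /negP; rewrite -ltNge.
Qed.

Lemma markov_ge (R : realType) d (T : measurableType d) (P : probability T R)
    (g : T -> \bar R) (c b : R) :
  measurable_fun setT g -> (forall t, 0 <= g t)%E -> 0 < c ->
  (\int[P]_t g t <= b%:E)%E ->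
  (P [set t | c%:E <= g t] <= (b / c)%:E)%E.
Proof.
move=> mg g0 c0 gb.
have mid : measurable_fun setT (id : \bar R -> \bar R) by exact: measurable_id.
have := le_integral_comp_abse P measurableT (f := id) mid
  (fun r r0 => r0) (fun _ _ _ _ => id) mg c0.
rewrite setTI => h.
have {}h : (c%:E * P [set t | c%:E <= g t] <= b%:E)%E.
  apply: le_trans (le_trans h _).
    rewrite lee_pmul2l ?lte_fin// le_eqVlt; apply/orP; left; apply/eqP.
    by congr (P _); apply/seteqP; split => t /=; rewrite gee0_abs.
  apply: le_trans gb; rewrite le_eqVlt; apply/orP; left; apply/eqP.
  by apply: eq_integral => t _; rewrite gee0_abs.
by rewrite EFinM lee_pdivlMr// muleC.
Qed.

(** * Deviation of one of the two integrals *)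

(** Hölder continuity followed by [powR_le_expR] at |p - q|, with exp(lambda |p - q|) replaced by
    the sum of both signs. The result is affine in [exp_deviation], hence ready for integration over
    levels. *)
Lemma weight_deviation_le (R : realType) (w : R -> R)
    (alpha L lambda x p q : R) :
  0 < alpha -> alpha <= 1 -> 0 < L -> 0 < lambda -> 0 < x ->
  holder01 alpha L w -> 0 <= p <= 1 -> 0 <= q <= 1 ->
  `|w p - w q| <= L * x `^ alpha * (1 - alpha / (lambda * x)) +
    L * x `^ alpha * (alpha / (lambda * x)) * expR (- (lambda * x)) *
    (expR (lambda * (p - q)) + expR (- lambda * (p - q))).
Proof.
move=> al0 al1 L0 l0 x0 hw p01 q01.
apply: le_trans (hw p q p01 q01) _.
have := powR_le_expR al0 al1 l0 x0 (normr_ge0 (p - q)).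
set kappa := alpha / (lambda * x); set S := _ + expR (- lambda * _).
have k0 : 0 <= kappa by rewrite divr_ge0 ?mulr_ge0 ?ltW.
have h : expR (lambda * (`|p - q| - x)) <= expR (- (lambda * x)) * S.
  have -> : lambda * (`|p - q| - x) = - (lambda * x) + lambda * `|p - q| by ring.
  rewrite expRD ler_wpM2l ?expR_ge0// /S.
  have [pq|pq] := leP 0 (p - q).
    by rewrite ger0_norm// lerDl expR_ge0.
  by rewrite ltr0_norm// mulrN -mulNr lerDr expR_ge0.
move=> /(ler_wpM2l (ltW L0))/le_trans; apply.
rewrite [leLHS]mulrA -(mulrA (L * _ * kappa)) -(mulrA (L * _) kappa) -mulrDr.
rewrite ler_wpM2l ?mulr_ge0 ?powR_ge0 ?(ltW L0)//.
have := ler_wpM2l k0 h; lra.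
Qed.

Lemma cpt_part_deviation (R : realType) (u w : R -> R) (alpha L U delta : R)
    d (T : measurableType d) (P : probability T R) (X : {RV P >-> R})
    n (Xs : 'I_n -> {RV P >-> R}) :
  measurable_fun setT u -> weight_function w -> holder01 alpha L w ->
  0 < alpha -> alpha <= 1 -> 0 < L -> 0 < U -> 0 < delta ->
  {ae P, forall t, u (X t) <= U} -> iid_sample X Xs -> (0 < n)%N ->
  (P [set t | (delta <
      `|\int[lebesgue_measure]_(z in `[0, +oo[) w (empirical_tail u (Xs ^~ t) z)
       - \int[lebesgue_measure]_(z in `[0, +oo[) w (tail_prob u X z)|)%R]
   <= (2 * expR (- (n%:R / 8) * (delta / (L * U)) `^ (2 / alpha)))%:E)%E.
Proof.
move=> mu ww hw al0 al1 L0 U0 delta0 XU iid n0.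
have [w01 _ _ w0 _] := ww.
have nR0 : 0 < n%:R :> R by rewrite ltr0n.
have [PXU [N [mN PN XsN]]] := sample_le_ae mu iid XU.
have mU := measurable_superlevel U mu.
set D := (delta / (L * U)) `^ (2 / alpha).
(* The point [x] solves L U x^alpha = delta. *)
pose x := (delta / (L * U)) `^ (alpha^-1).
have q0 : 0 < delta / (L * U) by rewrite divr_gt0 ?mulr_gt0.
have x0 : 0 < x by rewrite powR_gt0.
have xal : x `^ alpha = delta / (L * U).
  by rewrite -powRrM mulVf ?gt_eqF// powRr1// ltW.
have x2 : x ^+ 2 = D.
  by rewrite -powR_mulrn ?ltW// -powRrM /D (mulrC 2).
(* Markov's inequality will give the exponent 2 lambda^2 / n - lambda x; this choice minimises it,
   with value -n x^2 / 8. *)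
pose lambda := n%:R * x / 4.
have l0 : 0 < lambda by rewrite divr_gt0 ?mulr_gt0.
have leb : lebesgue_measure `[0%R, U[%classic = U%:E :> \bar R.
  by rewrite lebesgue_measure_itv/= lte_fin U0 oppr0 adde0.
have mM := measurable_exp_deviation X Xs lambda mu.
have M0 y : 0 <= exp_deviation u X Xs lambda y by rewrite addr_ge0 ?expR_ge0.
pose I t := (\int[lebesgue_measure]_(z in `[0%R, U[)
  (exp_deviation u X Xs lambda (t, z))%:E)%E.
have [mI _] := tonelli_section P (measurable_itv `[0, U[) mM M0.
have tail0 z : U <= z -> tail_prob u X z = 0.
  move=> Uz; rewrite /tail_prob (@subset_measure0 _ _ _ (distribution P X) _ [set x | U < u x])//.
  - exact: measurable_superlevel.
  - by move=> y /=; exact: le_lt_trans.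
have mtail : measurable_fun setT (w \o tail_prob u X).
  apply: measurable_weight => //; last exact: measurable_tail_prob.
  by move=> z; exact: tail_prob_01.
pose E := [set t | (U * expR (lambda * x))%:E <= I t]%E.
have mE : measurable E.
  rewrite -[X in measurable X]setTI.
  exact: emeasurable_fun_c_infty.
have PE : (P E <= (2 * expR (- (n%:R / 8) * D))%:E)%E.
  have c0 : 0 < U * expR (lambda * x) by rewrite mulr_gt0 ?expR_gt0.
  have I0 t : (0 <= I t)%E by apply: integral_ge0 => z _; rewrite lee_fin.
  have EI := expectation_integral_exp_deviation lambda mu iid n0 U0.
  apply: le_trans (markov_ge mI I0 c0 EI) _.
  have -> : U * (2 * expR (2 * lambda ^+ 2 / n%:R)) / (U * expR (lambda * x)) =
      2 * (expR (2 * lambda ^+ 2 / n%:R) * expR (- (lambda * x))).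
    by rewrite expRN; field; rewrite !gt_eqF ?expR_gt0.
  rewrite lee_fin -expRD ler_pM2l// ler_expR -x2 /lambda le_eqVlt; apply/orP; left; apply/eqP.
  by field; rewrite gt_eqF.
set F := (X in P X).
have mF : measurable F.
  exact: measurable_deviation (measurable_cpt_part Xs mu ww).
(* [N] is the null set outside which all samples satisfy the bound [U]; off [N] a large deviation
   must put the outcome in [E]. *)
suff FNE : F `<=` N `|` E.
  apply: le_trans PE; rewrite (le_trans (le_measure _ _ _ FNE)) ?inE//.
    exact: measurableU.
  rewrite (le_trans (measureU2 _ _ _))// -[leRHS]add0e leeD//.
  by rewrite le_eqVlt; apply/orP; left; apply/eqP; exact: PN.
move=> t Ft; have [Nt|Nt] := pselect (N t); [by left|right].
have XsU i : u (Xs i t) <= U.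
  by move: i; apply: contrapT => H; apply: Nt; exact: XsN.
have emp0 z : U <= z -> empirical_tail u (Xs ^~ t) z = 0.
  move=> Uz; rewrite /empirical_tail big1 ?mulr0// => i _.
  by rewrite ltNge (le_trans (XsU i) Uz).
have memp : measurable_fun setT (w \o empirical_tail u (Xs ^~ t)).
  apply: measurable_weight => //.
    by move=> z; exact: empirical_tail_01.
  exact: measurableT_comp (measurable_empirical_tail Xs mu) (pair1_measurable t).
have mMt : measurable_fun setT (fun z => exp_deviation u X Xs lambda (t, z)).
  exact: measurableT_comp mM (pair1_measurable t).
have w_norm p : 0 <= p <= 1 -> `|w p| <= 1.
  by move=> /w01/andP[w0p w1p]; rewrite ger0_norm.
have iemp := integrable_bounded_itv U memp
  (fun z => w_norm _ (empirical_tail_01 u (Xs ^~ t) z)).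
have itail := integrable_bounded_itv U mtail
  (fun z => w_norm _ (tail_prob_01 X z mu)).
have M_le z : `|exp_deviation u X Xs lambda (t, z)| <= 2 * expR lambda.
  rewrite ger0_norm// mulr_natl mulr2n /exp_deviation/=.
  have /andP[p0 p1] := empirical_tail_01 u (Xs ^~ t) z.
  have /andP[r0 r1] := tail_prob_01 X z mu.
  by rewrite lerD// ler_expR; nra.
have iM := integrable_bounded_itv U mMt M_le.
have dev z (_ : `[0, U[%classic z) := weight_deviation_le al0 al1 L0 l0 x0 hw
  (empirical_tail_01 u (Xs ^~ t) z) (tail_prob_01 X z mu).
have := le_dist_Rintegral _ _ iemp itail iM dev.
rewrite /E/=; have -> : I t = (\int[lebesgue_measure]_(z in `[0, U[)
    exp_deviation u X Xs lambda (t, z))%:E.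
  by rewrite fineK// integrable_fin_num.
move: Ft; rewrite /F /=.
rewrite (Rintegral_weight_trunc w0 emp0) (Rintegral_weight_trunc w0 tail0).
rewrite leb/= ltry => dlt /(_ (measurable_itv `[0, U[) isT) /(lt_le_trans dlt).
set r := \int[lebesgue_measure]_(z in `[0, U[) exp_deviation u X Xs lambda (t, z).
rewrite xal lee_fin; set kappa := alpha / (lambda * x).
have k0 : 0 < kappa by rewrite divr_gt0// mulr_gt0.
(* Since L U x^alpha = delta, the integrated bound is delta plus a positive multiple of exp(-lambda
   x) r - U. Exceeding delta thus forces r > U exp(lambda x). *)
have -> : L * (delta / (L * U)) * (1 - kappa) * U +
    L * (delta / (L * U)) * kappa * expR (- (lambda * x)) * r =
    delta + delta * kappa / U * (expR (- (lambda * x)) * r - U).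
  by field; rewrite !gt_eqF.
rewrite ltrDl pmulr_rgt0; last by rewrite divr_gt0// mulr_gt0.
rewrite subr_gt0 expRN mulrC ltr_pdivlMr ?expR_gt0//.
exact: ltW.
Qed.

(** * Bounds on the utilities and combination of the two integrals *)

(** Mean value theorem on [0, x]: continuity handles the endpoint 0, where differentiability is not
    assumed. *)
Lemma gain_utility_le (R : realType) (k K : R) (u : R -> R) (x : R) :
  gain_utility k K u -> 0 <= x -> u x <= K * x.
Proof.
move=> [[_ cu] u0 _ du]; rewrite le_eqVlt => /predU1P[<-|x0].
  by rewrite u0// mulr0.
have [c|c cx] := MVT x0 _ (continuous_subspaceT cu) (df := derive1 u).
  rewrite in_itv/= => /andP[c0 _]; rewrite derive1E; apply/derivableP.
  by have [] := du c c0.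
rewrite (u0 0)// !subr0 => ->; rewrite ler_wpM2r ?(ltW x0)//.
move: cx; rewrite in_itv/= => /andP[c0 _].
by have [_ /andP[_]] := du c c0; exact/le_trans/ler_norm.
Qed.

Lemma loss_utility_le (R : realType) (k K : R) (u : R -> R) (x : R) :
  loss_utility k K u -> x <= 0 -> u x <= K * - x.
Proof.
move=> [[_ cu] u0 _ du]; rewrite le_eqVlt => /predU1P[->|x0].
  by rewrite u0// oppr0 mulr0.
have [c|c cx] := MVT x0 _ (continuous_subspaceT cu) (df := derive1 u).
  rewrite in_itv/= => /andP[_ c0]; rewrite derive1E; apply/derivableP.
  by have [] := du c c0.
rewrite (u0 0)// !sub0r => /eqP; rewrite eqr_oppLR -mulNr => /eqP ->.
rewrite ler_wpM2r ?oppr_ge0 ?(ltW x0)//.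
move: cx; rewrite in_itv/= => /andP[_ c0].
by have [_ /andP[_]] := du c c0; apply: le_trans; rewrite -normrN ler_norm.
Qed.

Lemma cpt_estE (R : realType) (up um wp wm : R -> R) d (T : measurableType d)
    (P : probability T R) n (Xs : 'I_n -> {RV P >-> R}) (t : T) :
  measurable_fun setT up -> measurable_fun setT um ->
  cpt_est up um wp wm Xs t =
  \int[lebesgue_measure]_(z in `[0, +oo[) wp (empirical_tail up (Xs ^~ t) z)
  - \int[lebesgue_measure]_(z in `[0, +oo[) wm (empirical_tail um (Xs ^~ t) z).
Proof.
move=> mup mum.
have tailE (u : R -> R) : measurable_fun setT u -> forall z,
    fine (lebesgue_stieltjes_measure (ecdf (fun i => Xs i t)) [set x | z < u x])
    = empirical_tail u (Xs ^~ t) z.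
  move=> mu z; rewrite lebesgue_stieltjes_ecdf/=; last exact: measurable_superlevel.
  congr (_ * _); apply: eq_bigr => i _; rewrite indicE.
  congr (_%:R); congr nat_of_bool.
  by apply/idP/idP => [/set_mem//|?]; exact/mem_set.
by congr (_ - _); apply: eq_Rintegral => z _; rewrite tailE.
Qed.

(** Evaluating the slope bounds at 1 and -1 shows that the ratios in tau are at least 1, so that tau
    dominates both B1 and B2. *)
Lemma slopes_le (R : realType) (kp km Kp Km : R) (up um : R -> R) :
  gain_utility kp Kp up -> loss_utility km Km um -> kp <= Kp /\ km <= Km.
Proof.
move=> [_ _ _ dup] [_ _ _ dum]; split.
  by have [_ /andP[]] := dup 1 ltr01; exact: le_trans.
have N1 : -1 < 0 :> R by rewrite oppr_lt0.
by have [_ /andP[]] := dum (-1) N1; exact: le_trans.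
Qed.

Theorem corollary36 (R : realType) (B1 B2 Kp Km alpha : R)
    (B1_ge0 : 0 <= B1) (B2_ge0 : 0 <= B2) (B_gt0 : 0 < B1 \/ 0 < B2)
    (Kp_gt0 : 0 < Kp) (Km_gt0 : 0 < Km)
    (alpha_gt0 : 0 < alpha) (alpha_le1 : alpha <= 1) :
  exists c1 c2 : R, 0 < c1 /\ 0 < c2 /\
  forall (kp km L : R) (up um wp wm : R -> R)
         (d : measure_display) (T : measurableType d) (P : probability T R)
         (X : {RV P >-> R}) (eps : R) (n : nat) (Xs : 'I_n -> {RV P >-> R}),
    0 < kp -> 0 < km -> 0 < L ->
    gain_utility kp Kp up -> loss_utility km Km um ->
    weight_function wp -> weight_function wm ->
    holder01 alpha L wp -> holder01 alpha L wm ->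
    {ae P, forall t, - B2 <= X t <= B1} ->
    iid_sample X Xs ->
    0 < eps -> (1 <= n)%N ->
    let tau := Num.max (B1 * (Kp / kp)) (B2 * (Km / km)) in
    (P [set t | (eps < `|cpt_est up um wp wm Xs t - cpt up um wp wm X|)%R] <=
     (c1 * expR (- c2 * n%:R *
                 (eps / (L * tau `^ (1 - alpha))) `^ (2 / alpha)))%:E)%E.
Proof.
pose B := Num.max B1 B2; pose K := Num.max Kp Km.
have B0 : 0 < B by rewrite lt_max; case: B_gt0 => ->; rewrite ?orbT.
have K0 : 0 < K by rewrite lt_max Kp_gt0.
have KB0 : 0 < K * B `^ alpha by rewrite mulr_gt0// powR_gt0.
(* Two integrals, each with the factor 2, give 4. In the second constant 1/8 is the optimised
   exponent, and the power is what remains of (eps/2) / (L U) for U = K B^alpha tau^(1 - alpha) once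
   eps / (L tau^(1 - alpha)) is split off. *)
exists 4, (8^-1 * (2 * (K * B `^ alpha))^-1 `^ (2 / alpha)).
split => //; split.
  by rewrite mulr_gt0// powR_gt0// invr_gt0 mulr_gt0.
move=> kp km L up um wp wm d T P X eps n Xs kp0 km0 L0 gup lum wwp wwm hwp hwm.
move=> XB iid eps0 n0; cbv zeta; set tau := Num.max _ _.
have [kpK kmK] := slopes_le gup lum.
have mup : measurable_fun setT up.
  by apply: continuous_measurable_fun; case: gup => -[].
have mum : measurable_fun setT um.
  by apply: continuous_measurable_fun; case: lum => -[].
have tauB : B <= tau.
  rewrite /tau ge_max !le_max !ler_peMr// ?orbT//.
  - by rewrite ler_pdivlMr// mul1r.
  - by rewrite ler_pdivlMr// mul1r.
have tau0 : 0 < tau by exact: lt_le_trans tauB.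
(* [B <= tau] makes [U] a bound of both utilities, with the dependence on [tau]
   required in the exponent. *)
pose U := K * B `^ alpha * tau `^ (1 - alpha).
have U0 : 0 < U by rewrite mulr_gt0 ?powR_gt0.
have KBU : K * B <= U.
  have -> : K * B = K * B `^ alpha * B `^ (1 - alpha).
    rewrite -mulrA -powRD; last by rewrite (gt_eqF B0) implybT.
    by rewrite (_ : alpha + (1 - alpha) = 1) ?powRr1 ?(ltW B0)//; ring.
  rewrite ler_pM2l// ge0_ler_powR ?nnegrE ?subr_ge0 ?(ltW B0) ?(ltW tau0)//.
have upU : {ae P, forall t, up (X t) <= U}.
  apply: filterS XB => t /andP[_ XB1]; apply: le_trans KBU.
  have [X0|X0] := leP 0 (X t); last first.
    by have [_ -> //] := gup; rewrite ?mulr_ge0 ?ltW.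
  rewrite (le_trans (gain_utility_le gup X0))// ler_pM ?(ltW Kp_gt0)//.
    by rewrite le_max lexx.
  by rewrite (le_trans XB1)// le_max lexx.
have umU : {ae P, forall t, um (X t) <= U}.
  apply: filterS XB => t /andP[XB2 _]; apply: le_trans KBU.
  have [X0|X0] := leP (X t) 0; last first.
    by have [_ -> //] := lum; rewrite ?mulr_ge0 ?ltW.
  rewrite (le_trans (loss_utility_le lum X0))// ler_pM ?oppr_ge0 ?(ltW Km_gt0)//.
    by rewrite le_max lexx orbT.
  by rewrite lerNl (le_trans _ XB2)// lerN2 le_max lexx orbT.
have e0 : 0 < eps / 2 by rewrite divr_gt0.
have devp := cpt_part_deviation mup wwp hwp alpha_gt0 alpha_le1 L0 U0 e0 upU iid n0.
have devm := cpt_part_deviation mum wwm hwm alpha_gt0 alpha_le1 L0 U0 e0 umU iid n0.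
have mCp := measurable_cpt_part Xs mup wwp.
have mCm := measurable_cpt_part Xs mum wwm.
move: devp devm.
set Cp := fun t => \int[lebesgue_measure]_(z in `[0, +oo[)
  wp (empirical_tail up (Xs ^~ t) z) in mCp *.
set Cm := fun t => \int[lebesgue_measure]_(z in `[0, +oo[)
  wm (empirical_tail um (Xs ^~ t) z) in mCm *.
pose cp := \int[lebesgue_measure]_(z in `[0, +oo[) wp (tail_prob up X z).
pose cm := \int[lebesgue_measure]_(z in `[0, +oo[) wm (tail_prob um X z).
have -> : (eps / 2 / (L * U)) `^ (2 / alpha) =
    (2 * (K * B `^ alpha))^-1 `^ (2 / alpha) *
    (eps / (L * tau `^ (1 - alpha))) `^ (2 / alpha).
  rewrite -powRM ?invr_ge0 ?divr_ge0 ?mulr_ge0 ?powR_ge0 ?ltW//.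
  congr (_ `^ _); rewrite /U; field.
  by rewrite !gt_eqF ?powR_gt0.
set c := (2 * _)^-1 `^ _; set D := (eps / (L * _)) `^ _ => devp devm.
have mF f b := @measurable_deviation R d T f b (eps / 2).
(* An error above [eps] in the difference forces an error above [eps / 2] in one of the two
   integrals. *)
apply: (@le_trans _ _ (P ([set t | eps / 2 < `|Cp t - cp|] `|`
                          [set t | eps / 2 < `|Cm t - cm|]))).
  apply: le_measure; rewrite ?inE.
  - apply: measurable_deviation.
    rewrite (_ : cpt_est _ _ _ _ _ = fun t => Cp t - Cm t); last first.
      by apply/funext => t; rewrite cpt_estE.
    exact: measurable_funB.
  - by apply: measurableU; exact: mF.
  - move=> t /=; rewrite cpt_estE// -/(Cp t) -/(Cm t).
    have -> : cpt up um wp wm X = cp - cm by [].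
    move=> epst; apply/orP; rewrite -[_ || _]negbK negb_or -!leNgt.
    apply/negP => /andP[hp hm]; move: epst; rewrite ltNge => /negP; apply.
    have -> : Cp t - Cm t - (cp - cm) = (Cp t - cp) - (Cm t - cm) by ring.
    by rewrite (le_trans (ler_normB _ _))// (le_trans (lerD hp hm))// -splitr.
apply: (le_trans (measureU2 _ (mF _ _ mCp) (mF _ _ mCm))).
apply: (le_trans (leeD devp devm)).
rewrite -EFinD lee_fin -mulrDl le_eqVlt; apply/orP; left; apply/eqP.
by congr (_ * expR _); field.
Qed.
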